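(* Let $n\ge 4$, let $\mathbb{K}$ be a field, and let $G$ be a finite simple graph on $[n]$ with no isolated vertices. Then the following are equivalent: (1) $I_c(G)$ has pure resolution. (2) $G$ is connected or a disjoint union of edges.
   Context: $S=\mathbb{K}[x_1,\dots,x_n]$ is the standard graded polynomial ring and $[n]=\{1,\dots,n\}$. For a simple graph $G$ with vertex set $[n]$ and edge set $E(G)$, the complementary edge ideal is $I_c(G)=(x_1\cdots x_n/(x_ix_j) : \{i,j\}\in E(G))\subset S$. A graded ideal $I$ has pure resolution if in each step of its minimal graded free resolution only one shift degree appears, i.e. for each $i$ there is at most one $j$ with $\beta_{i,j}(I)\ne 0$. A graph is a disjoint union of edges if every connected component consists of a single edge and its two endpoints. *)

(* Defs.v *)
From HB Require Import structures.
From mathcomp Require Import all_boot all_order all_algebra.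
From mathcomp Require Import mpoly.

Set Implicit Arguments.
Unset Strict Implicit.
Unset Printing Implicit Defensive.

Import GRing.Theory.
Local Open Scope ring_scope.

Section PureResolution.

Variables (n : nat) (K : fieldType).
Local Notation S := {mpoly K[n]}.

Definition ideal_gen (A : S -> Prop) (f : S) : Prop :=
  exists (m : nat) (c g : 'I_m -> S),
    (forall k, A (g k)) /\ f = \sum_(k < m) c k * g k.

(* F_i is the direct sum of the S(- gshift i k) for k < grank i. Elements of
   F_i are row vectors, on which the matrices act by right multiplication, so
   that gdiff i : F_{i+1} -> F_i and gaug : F_0 -> S. The shifts are naturals
   because in a minimal resolution of an ideal of S no generator is in
   negative degree. *)
Record graded_free_seq := GradedFreeSeq {
  grank : nat -> nat;
  gshift : forall i, 'I_(grank i) -> nat;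
  gdiff : forall i, 'M[S]_(grank i.+1, grank i);
  gaug : 'cV[S]_(grank 0)
}.

(* An entry of a degree-preserving map S(-a) -> S(-b): it is homogeneous of
   degree a - b, hence zero if a < b. *)
Definition homog_entry (a b : nat) (f : S) : Prop :=
  if (b <= a)%N then is_true (f \is (a - b)%N.-homog) else f = 0.

Definition graded_maps (F : graded_free_seq) : Prop :=
  (forall k, homog_entry (gshift k) 0 (gaug F k 0)) /\
  (forall i k l, homog_entry (gshift k) (gshift l) (gdiff F i k l)).

Definition resolves (F : graded_free_seq) (I : S -> Prop) : Prop :=
  [/\ forall f, I f <-> exists v : 'rV_(grank F 0), f = (v *m gaug F) 0 0,
      forall v : 'rV_(grank F 0),
        v *m gaug F = 0 <-> exists w, v = w *m gdiff F 0
    & forall i (v : 'rV_(grank F i.+1)),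
        v *m gdiff F i = 0 <-> exists w, v = w *m gdiff F i.+1].

(* The image of F_{i+1} lies in (x_1, ..., x_n) F_i. Nothing is required of
   gaug, which is not a differential of the resolution of the ideal. *)
Definition minimal (F : graded_free_seq) : Prop :=
  forall i k l, (gdiff F i k l)@_0%MM = 0.

Definition minimal_graded_resolution (F : graded_free_seq) (I : S -> Prop) :=
  [/\ graded_maps F, resolves F I & minimal F].

Definition betti (F : graded_free_seq) (i j : nat) : nat :=
  #|[set k : 'I_(grank F i) | gshift k == j]|.

(* Every graded ideal has a minimal graded free resolution, unique up to graded
   isomorphism, so the Betti numbers may be read off any one of them. *)
Definition has_pure_resolution (I : S -> Prop) : Prop :=
  exists F : graded_free_seq, minimal_graded_resolution F I /\
    forall i j j', betti F i j != 0 -> betti F i j' != 0 -> j = j'.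

Definition complementary_edge_ideal (e : rel 'I_n) : S -> Prop :=
  ideal_gen (fun g => exists i j : 'I_n,
    e i j /\ g = \prod_(k < n | (k != i) && (k != j)) 'X_k).

End PureResolution.

Arguments complementary_edge_ideal {n} K e _.

Section Graphs.

Variables (n : nat) (e : rel 'I_n).

Definition no_isolated_vertex : Prop := forall i : 'I_n, exists j, e i j.

Definition graph_connected : Prop := forall i j : 'I_n, connect e i j.

Definition disjoint_union_of_edges : Prop :=
  forall i : 'I_n, exists u v, e u v /\ [set j | connect e i j] = [set u; v].

End Graphs.

(* Main.v *)
Require Import Defs.
From HB Require Import structures.
From mathcomp Require Import mpoly ring.
From mathcomp Require Import all_boot all_order all_algebra.

(** Write X for the product of all variables. For an edge ij, the generator of
the ideal is X / (x_i x_j), and the relations between generators have two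
sources. Two edges ij, ik with a common vertex give a linear relation, both
sides being X / x_i; any two edges give a relation in which both sides are X,
with quadratic coefficients. Both kinds are needed exactly when some vertex has
two neighbours and the graph is disconnected.

Purity forces one of the two cases. The generators of a pure resolution all
have degree n - 2. Restrict a syzygy of the edge monomials to the edges of one
connected component C: the resulting polynomial is divisible by x_v for v
outside C because no edge of C contains v, and for v inside C because it is
minus the sum over the other components [dvdX_comp_part]. Hence its monomials
have degree at least n, and it vanishes on every syzygy of degree less than n.
On the quadratic relation between edges of two components it equals X, so the
first syzygies have a generator in degree at least n; a vertex with two
neighbours gives a nonzero syzygy in degree n - 1, hence a generator in degree
less than n. Both cannot happen in a pure resolution
[pure_no_cherry_and_split].

Conversely, both kinds of graph have an explicit pure resolution whose free
modules are S tensored with vector spaces of functions on edges or on darts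
(oriented edges). Bases of these spaces over K give bases over S with the same
coordinate maps [const_basisP], so exactness can be checked on functions, where
it reduces to setting one or two variables to zero.

For a disjoint union of edges, a syzygy entry s_ij is divisible by x_i x_j, and
the quotients sum to zero: the first syzygies are S tensored with the functions
of sum zero on edges, and there are no second syzygies [matching_pure].

For a connected graph, the first syzygies are S tensored with the functions z
on darts whose sum around every vertex is zero; z is sent to the syzygy with
entries x_j z_ij + x_i z_ji. To lift a syzygy s, setting x_i and x_j to zero
gives s_ij = x_j a_ij + x_i a_ji for some a; the sum of a around i is x_i b_i
with b of total zero, and as the graph is connected b is the divergence of an
antisymmetric flow f, so that a_ij - x_i f_ij is a lift [syzygy_lift]. If the
syzygy of z is zero, then x_i divides z_ij and the quotients y_ij = z_ij / x_i
are antisymmetric: the second syzygies are S tensored with the cycle space of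
the graph, placed in degree n [connected_pure]. *)

Set Implicit Arguments.
Unset Strict Implicit.
Unset Printing Implicit Defensive.

Import GRing.Theory.
Local Open Scope ring_scope.

(** * Squarefree monomials and setting a variable to zero *)

Section Poly.
Variables (n : nat) (K : fieldType).
Local Notation S := {mpoly K[n]}.

(** Substitution of 0 for x_v, a ring endomorphism: it detects divisibility by
x_v and keeps only those monomials that avoid x_v. *)
Definition kill (v : 'I_n) : S -> S :=
  comp_mpoly [tuple if i == v then 0 else 'X_i | i < n].
HB.instance Definition _ v := GRing.LRMorphism.copy (kill v)
  (comp_mpoly [tuple if i == v then 0 else 'X_i | i < n]).

Lemma kill_sum v (I : finType) (P : pred I) (f : I -> S) :
  kill v (\sum_(i | P i) f i) = \sum_(i | P i) kill v (f i).
Proof. exact: raddf_sum. Qed.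

Lemma killX v k : kill v 'X_k = if k == v then 0 else 'X_k.
Proof. by rewrite /kill comp_mpolyXU -tnth_nth tnth_mktuple. Qed.

Lemma killXv v : kill v 'X_v = 0.
Proof. by rewrite killX eqxx. Qed.

(** The polynomials for which this holds form a subring containing the
variables and the constants. *)
Lemma kill_split v p : exists q, p = kill v p + 'X_v * q.
Proof.
pose P p := exists q, p = kill v p + 'X_v * q.
have PM p1 p2 : P p1 -> P p2 -> P (p1 * p2).
  move=> [q1 E1] [q2 E2]; exists (q1 * p2 + kill v p1 * q2);
    rewrite /P rmorphM /=.
  by move: E1 E2; move: (kill v p1) (kill v p2) => k1 k2 -> ->; ring.
have P1 : P 1 by exists 0; rewrite rmorph1 mulr0 addr0.
have PX k : P 'X_k.
  rewrite /P killX; case: eqP => [->|_]; first by exists 1; rewrite mulr1 add0r.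
  by exists 0; rewrite mulr0 addr0.
elim/mpolyind: p => [|c m p _ _ [q Eq]]; first by exists 0;
  rewrite raddf0 mulr0 addr0.
have [q' Eq'] : P 'X_[m].
  rewrite mpolyXE_id; apply: big_ind => // k _.
  elim: (m k) => [|i IH]; first by rewrite expr0.
  by rewrite exprS; apply: PM.
exists (c *: q' + q); rewrite raddfD /= linearZ /= {1}Eq {1}Eq' -!mul_mpolyC;
  ring.
Qed.

Lemma kill_eq0 v p : kill v p = 0 -> exists q, p = 'X_v * q.
Proof. by move=> p0; have [q] := kill_split v p; rewrite p0 add0r;
  exists q. Qed.

Lemma X_neq0 v : 'X_v != 0 :> S.
Proof.
by apply/eqP => /(congr1 (mcoeff U_(v))); rewrite mcoeffXU eqxx mcoeff0;
  apply/eqP/oner_neq0.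
Qed.

(** These are X / (x_i x_j) for i <> j, X / x_i and X, where X is the product of
all variables; products make sense of the quotients. *)
Definition edge_mon (i j : 'I_n) : S :=
  \prod_(k < n | (k != i) && (k != j)) 'X_k.
Definition vertex_mon (i : 'I_n) : S := \prod_(k < n | k != i) 'X_k.
Definition all_mon : S := \prod_(k < n) 'X_k.

Lemma edge_mon_neq0 i j : edge_mon i j != 0.
Proof. by apply/prodf_neq0 => k _; apply: X_neq0. Qed.
Lemma vertex_mon_neq0 i : vertex_mon i != 0.
Proof. by apply/prodf_neq0 => k _; apply: X_neq0. Qed.
Lemma all_mon_neq0 : all_mon != 0.
Proof. by apply/prodf_neq0 => k _; apply: X_neq0. Qed.

Lemma edge_monC i j : edge_mon i j = edge_mon j i.
Proof. by apply: eq_bigl => k; rewrite andbC. Qed.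

Lemma X_vertex_mon i : 'X_i * vertex_mon i = all_mon.
Proof. by rewrite /all_mon (bigD1 i). Qed.

Lemma X_edge_mon i j : i != j -> 'X_j * edge_mon i j = vertex_mon i.
Proof.
by move=> ij; rewrite /vertex_mon (bigD1 j) 1?eq_sym.
Qed.

Lemma kill_prod (P : pred 'I_n) v :
  kill v (\prod_(k < n | P k) 'X_k) =
    if P v then 0 else \prod_(k < n | P k) 'X_k.
Proof.
rewrite rmorph_prod /=; case: ifPn => Pv.
  by rewrite (bigD1 v) //= killXv mul0r.
by apply: eq_bigr => k Pk; rewrite killX; case: eqP => // kv;
  rewrite -kv Pk in Pv.
Qed.

Lemma kill_edge_mon v i j :
  kill v (edge_mon i j) = if (v == i) || (v == j) then edge_mon i j else 0.
Proof. by rewrite kill_prod -negb_or if_neg. Qed.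

Lemma kill_vertex_mon v i :
  kill v (vertex_mon i) = if v == i then vertex_mon i else 0.
Proof. by rewrite kill_prod if_neg. Qed.

Lemma homog_X v : ('X_v : S) \is 1.-homog.
Proof. by rewrite dhomogX /= mdeg1. Qed.

Lemma homog_prodX (P : pred 'I_n) :
  (\prod_(k < n | P k) 'X_k : S) \is #|P|.-homog.
Proof.
rewrite -sum1_card; apply: (big_ind2 (fun d (p : S) => p \is d.-homog)).
- exact: dhomog1.
- by move=> d p e q Hp Hq; apply: dhomogM.
- by move=> k _; apply: homog_X.
Qed.

Lemma homog_edge_mon i j : i != j -> edge_mon i j \is (n - 2).-homog.
Proof.
move=> ij; have := homog_prodX (fun k => (k != i) && (k != j)).
suff -> : #|fun k : 'I_n => (k != i) && (k != j)| = (n - 2)%N by [].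
rewrite -[n in RHS]card_ord -cardsT -[2%N](_ : #|[set i; j]| = 2%N);
  last by rewrite cards2 ij.
rewrite -cardsDS ?subsetT // -[LHS]cardsE; congr #|pred_of_set _|.
by apply/setP => k; rewrite !inE negb_or andbT.
Qed.

Lemma dvdX_coeff_gt0 v (q : S) m : ('X_v * q)@_m != 0 -> (0 < m v)%N.
Proof.
rewrite mulrC; case: (posnP (m v)) => // mv;
  rewrite -mcoeff_msupp => /msuppM_le.
case/allpairsP => -[m1 m2] /= [_]; rewrite msuppX inE => /eqP -> mE.
by rewrite mE mnmDE mnm1E eqxx addnC in mv.
Qed.

Lemma coeffM_homog d (p q : S) m : q \is d.-homog -> (p * q)@_m != 0 ->
  (d <= mdeg m)%N.
Proof.
move=> /dhomogP hq; rewrite -mcoeff_msupp => /msuppM_le.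
case/allpairsP => -[m1 m2] /= [_ /hq <- ->].
by rewrite mdegD leq_addl.
Qed.

Lemma coeffM_homog_eq d (p q : S) m : q \is d.-homog -> mdeg m = d ->
  (p * q)@_m = p@_0 * q@_m.
Proof.
move=> /dhomogP hq md; rewrite -mcoeffCM; apply/eqP;
  rewrite -subr_eq0 -mcoeffB -mulrBl.
apply/negP => /negP; rewrite -mcoeff_msupp => /msuppM_le.
case/allpairsP => -[m1 m2] /= [m1p /hq m2d mE].
have m10 : m1 = 0%MM.
  by apply/eqP; rewrite -mdeg_eq0 -(eqn_add2r (mdeg m2)) -mdegD -mE md m2d.
by move: m1p; rewrite m10 mcoeff_msupp mcoeffB mcoeffC eqxx mulr1 subrr eqxx.
Qed.

(** Among homogeneous polynomials of one degree, a relation with polynomial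
coefficients already holds with their constant terms: compare the parts of
degree d. *)
Lemma homog_const_coef d (I : finType) (P : pred I) (f : S) (c g : I -> S) :
    f \is d.-homog -> (forall k, P k -> g k \is d.-homog) ->
    f = \sum_(k | P k) c k * g k ->
  f = \sum_(k | P k) (c k)@_0%MM *: g k.
Proof.
move=> hf hg fE; apply/mpolyP => m; have [md|md] := eqVneq (mdeg m) d.
  rewrite {1}fE !raddf_sum; apply: eq_bigr => k Pk /=.
  by rewrite mcoeffZ (coeffM_homog_eq _ (hg k Pk)).
rewrite (dhomog_nemf_coeff hf) // raddf_sum big1 // => k Pk /=.
by rewrite mcoeffZ (dhomog_nemf_coeff (hg k Pk)) ?mulr0.
Qed.

(** Such a polynomial is divisible by the product of all variables, of degree
n. *)
Lemma homog_dvdX_eq0 d (p : S) : p \is d.-homog -> (d < n)%N ->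
  (forall v, exists q, p = 'X_v * q) -> p = 0.
Proof.
move=> /dhomogP hp dn hv; apply/mpolyP => m; rewrite mcoeff0;
  apply/eqP/negP => /negP pm.
have := hp m; rewrite mcoeff_msupp pm => /(_ isT) /= mE; move: dn;
  rewrite -mE ltnNge => /negP[].
rewrite mdegE -[X in (X <= _)%N]card_ord -sum1_card; apply: leq_sum => v _.
by have [q pE] := hv v; apply: (@dvdX_coeff_gt0 v q); rewrite -pE.
Qed.

Lemma homog_coeff0 d (p : S) : p \is d.-homog -> (0 < d)%N -> p@_0%MM = 0.
Proof. by move=> hp d0;
  rewrite (dhomog_nemf_coeff hp) //= mdeg0 eq_sym -lt0n. Qed.

End Poly.

(** * Pure resolutions force the graph to be connected or a matching *)

Section Ideal.
Variables (n : nat) (K : fieldType) (e : rel 'I_n).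
Local Notation S := {mpoly K[n]}.
Local Notation edge_mon := (edge_mon K).
Local Notation dart := ('I_n * 'I_n)%type.

(** Summation over ordered pairs lists each generator twice, which does no harm
and avoids orienting the edges. *)
Lemma edge_idealP (f : S) : complementary_edge_ideal K e f <->
  exists s : dart -> S, f = \sum_(p | e p.1 p.2) s p * edge_mon p.1 p.2.
Proof.
split=> [[m [c [g [hg ->]]]]|[s ->]]; last first.
  pose A := [set p : dart | e p.1 p.2].
  exists #|A|, (fun k => s (enum_val k)),
    (fun k => edge_mon (enum_val k).1 (enum_val k).2).
  split=> [k|]; last first.
    by rewrite -(big_enum_val (fun p => s p * edge_mon p.1 p.2));
      apply: eq_bigl => p; rewrite inE.
  exists (enum_val k).1, (enum_val k).2; split=> //.
  by have := enum_valP k; rewrite inE.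
elim/big_ind: _ => [|x y [s1 ->] [s2 ->]|k _].
- by exists (fun _ => 0); rewrite big1 // => p _; rewrite mul0r.
- by exists (fun p => s1 p + s2 p); rewrite -big_split /=;
  apply: eq_bigr => p _; rewrite mulrDl.
have [i [j [eij ->]]] := hg k.
exists (fun p => if p == (i, j) then c k else 0).
rewrite -/(edge_mon i j) [RHS](bigD1 (i, j)) //= eqxx big1 ?addr0 //
  => p /andP[_ /negbTE ->].
by rewrite mul0r.
Qed.

Lemma edge_mon_in_ideal i j : e i j ->
  complementary_edge_ideal K e (edge_mon i j).
Proof.
move=> eij; apply/edge_idealP; exists (fun p => (p == (i, j))%:R).
rewrite [RHS](bigD1 (i, j)) //= eqxx mul1r big1 ?addr0 //
  => p /andP[_ /negbTE ->].
by rewrite mul0r.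
Qed.

Lemma dvdX_sum_edge_mon v (P : pred dart) (a : dart -> S) :
    (forall p, P p -> (v != p.1) && (v != p.2)) ->
  exists q, \sum_(p | P p) a p * edge_mon p.1 p.2 = 'X_v * q.
Proof.
move=> hP; apply: kill_eq0;
  rewrite raddf_sum big1 // => p /hP /andP[/negbTE v1 /negbTE v2].
by rewrite /= rmorphM /= kill_edge_mon v1 v2 mulr0.
Qed.

Hypothesis e_sym : symmetric e.
Hypothesis e_irr : irreflexive e.

Lemma dart_neq i j : e i j -> i != j.
Proof. by apply: contraTneq => ->; rewrite e_irr. Qed.

Section Component.
Variable c : pred 'I_n.
Hypothesis c_closed : forall i j, e i j -> c i = c j.

Definition comp_part (a : dart -> S) : S :=
  \sum_(p | e p.1 p.2 && c p.1) a p * edge_mon p.1 p.2.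

(** No edge of the component contains a vertex [v] outside it. For [v] inside,
the syzygy lets the sum be replaced by minus the sum over the other edges, none
of which contains [v]. *)
Lemma dvdX_comp_part a v : \sum_(p | e p.1 p.2) a p * edge_mon p.1 p.2 = 0 ->
  exists q, comp_part a = 'X_v * q.
Proof.
have neq p : e p.1 p.2 -> c v != c p.1 -> (v != p.1) && (v != p.2).
  by move=> ep vp; rewrite -negb_or; apply: contra vp => /orP[] /eqP -> //;
    rewrite (c_closed ep).
case cv: (c v) in neq *; last first.
  move=> _; apply: dvdX_sum_edge_mon => p /andP[ep cp]; apply: neq => //.
  by rewrite cp.
rewrite (bigID (fun p => c p.1)) /= => /eqP; rewrite addr_eq0 => /eqP D0.
have [p /andP[ep cp]|q qE] :=
  @dvdX_sum_edge_mon v (fun p : dart => e p.1 p.2 && ~~ c p.1) a.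
  by apply: neq => //; rewrite (negbTE cp).
by exists (- q); rewrite mulrN -qE -D0.
Qed.
End Component.

Lemma connect_closed i j k : e j k -> connect e i j = connect e i k.
Proof.
move=> ejk; apply/idP/idP => h; apply: (connect_trans h); apply: connect1 => //.
by rewrite e_sym.
Qed.

Lemma mulmx_gaug r (g : 'cV[S]_r) (s : 'rV[S]_r) :
  s *m g = 0 <-> \sum_k s 0 k * g k 0 = 0.
Proof.
split=> [h|h]; first by have := congr1 (fun M : 'M_1 => M 0 0) h; rewrite !mxE.
by apply/matrixP => x y; rewrite !ord1 !mxE.
Qed.

Lemma betti_shift (F : graded_free_seq n K) i (k : 'I_(grank F i)) :
  betti F i (gshift k) != 0.
Proof. by rewrite /betti -lt0n; apply/card_gt0P; exists k; rewrite inE. Qed.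

(** The two obstructing syzygies are that of the edges va, vb, of degree n - 1,
and that of the edges ii', jj' in different components, of degree n. The first
forces a generator of the first syzygies in degree less than n, the second one
in degree at least n. *)
Lemma pure_no_cherry_and_split (v a b i i' j j' : 'I_n) : (1 < n)%N ->
  has_pure_resolution (complementary_edge_ideal K e) ->
  e v a -> e v b -> a != b -> e i i' -> e j j' -> ~~ connect e i j -> False.
Proof.
move=> n_gt1 [F [[[gaugH gdiffH] [hI res0 _] _] pure]] eva evb ab eii' ejj'
  ncij.
pose g k := gaug F k 0.
have shiftE i0 (k l : 'I_(grank F i0)) : gshift k = gshift l.
  by apply: (pure i0); apply: betti_shift.
have hg k : g k \is (gshift k).-homog.
  by have := gaugH k; rewrite /homog_entry leq0n subn0.
have /fin_all_exists[A gA] k : exists s : dart -> S,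
    g k = \sum_(p | e p.1 p.2) s p * edge_mon p.1 p.2.
  apply/edge_idealP/hI; exists (delta_mx 0 k).
  by rewrite -rowE mxE.
have /fin_all_exists[B gB] (p : dart) : exists s : 'I_(grank F 0) -> S,
    e p.1 p.2 -> edge_mon p.1 p.2 = \sum_k s k * g k.
  case: (boolP (e p.1 p.2)) => ep; last by exists (fun _ => 0).
  have /hI[s sE] := edge_mon_in_ideal ep; exists (s 0) => _.
  by rewrite sE mxE.
have hgen (p : dart) : e p.1 p.2 -> edge_mon p.1 p.2 \is (n - 2).-homog.
  by move=> ep; apply/homog_edge_mon/dart_neq.
have exN0 (I : finType) (P : pred I) (f : I -> S) m :
    (\sum_(k | P k) f k)@_m != 0 -> exists2 k, P k & (f k)@_m != 0.
  move=> h; case: (pickP (fun k => P k && ((f k)@_m != 0))) => [k /andP[]|h0].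
    by exists k.
  case/eqP: h; rewrite raddf_sum big1 // => k Pk /=.
  by have := h0 k; rewrite Pk /= => /negbFE/eqP.
have exm (p : S) : p != 0 -> exists m, p@_m != 0.
  by move=> p0; exists (mlead p); rewrite -mcoeff_msupp mlead_supp.
(* The ideal is generated in degree n - 2 and vanishes below it, so the common
shift of F_0 can only be n - 2. *)
have shift0 (k : 'I_(grank F 0)) : gshift k = (n - 2)%N.
  have [m genm] := exm _ (edge_mon_neq0 K v a).
  have mE : mdeg m = (n - 2)%N.
    by apply: (dhomog_mf (hgen (v, a) eva)); rewrite mcoeff_msupp.
  have [l _ Bl] : exists2 l, true & (B (v, a) l * g l)@_m != 0.
    by apply: exN0; rewrite -(gB (v, a)).
  have gl0 : g l != 0 by apply: contraNneq Bl => ->; rewrite mulr0 mcoeff0.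
  have [m' glm'] := exm _ gl0.
  have m'E : mdeg m' = gshift l.
    by apply: (dhomog_mf (hg l)); rewrite mcoeff_msupp.
  have [p ep Ap] : exists2 p : dart,
      e p.1 p.2 & (A l p * edge_mon p.1 p.2)@_m' != 0.
    by apply: exN0; rewrite -gA.
  apply/eqP; rewrite (shiftE _ k l) eqn_leq -{1}mE (coeffM_homog (hg l) Bl)
    -m'E.
  by rewrite (coeffM_homog (hgen p ep) Ap).
have {}hg k : g k \is (n - 2).-homog by rewrite -(shift0 k).
(* By degree, the two families of generators are related by constant matrices A0
and B0. *)
pose A0 k p := (A k p)@_0%MM; pose B0 p k := (B p k)@_0%MM.
have {}gA k : g k = \sum_(p | e p.1 p.2) A0 k p *: edge_mon p.1 p.2.
  by apply: homog_const_coef (gA k).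
have {}gB p : e p.1 p.2 -> edge_mon p.1 p.2 = \sum_k B0 p k *: g k.
  by move=> ep; apply: homog_const_coef (gB p ep) => //; apply: hgen.
pose c := connect e i; have c_closed := @connect_closed i.
pose DA k := comp_part c (fun p => (A0 k p)%:MP).
(* The component part of the syzygy of edge monomials that A0 makes out of a
syzygy s of the given generators. *)
pose D (s : 'I_(grank F 0) -> S) := \sum_k s k * DA k.
have DE s : D s = comp_part c (fun p => \sum_k s k * (A0 k p)%:MP).
  rewrite /D /comp_part; under eq_bigr do rewrite big_distrr /=.
  rewrite exchange_big /=; apply: eq_bigr => p _; rewrite big_distrl /=.
  by apply: eq_bigr => k _; rewrite mulrA.
have hDA k : DA k \is (n - 2).-homog.
  by apply: rpred_sum => p /andP[ep _]; rewrite mul_mpolyC; apply/dhomogZ/hgen.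
have sumA (s : 'I_(grank F 0) -> S) :
    \sum_(p | e p.1 p.2) (\sum_k s k * (A0 k p)%:MP) * edge_mon p.1 p.2 =
      \sum_k s k * g k.
  under eq_bigr do rewrite big_distrl /=.
  rewrite exchange_big /=; apply: eq_bigr => k _; rewrite gA big_distrr /=.
  by apply: eq_bigr => p _; rewrite -mulrA mul_mpolyC.
have rowker l : row l (gdiff F 0) *m gaug F = 0.
  by apply/res0; exists (delta_mx 0 l); rewrite rowE.
have Drow l : (gshift l < n)%N -> D (gdiff F 0 l) = 0.
  move=> ln; have := gdiffH 0%N l; rewrite /homog_entry => hl.
  apply: (@homog_dvdX_eq0 _ _ (gshift l)) => //.
    apply: rpred_sum => k _; have := hl k; rewrite shift0;
      case: leqP => [le hk|_ ->].
      by rewrite -(subnK le); apply: dhomogM.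
    by rewrite mul0r; apply: rpred0.
  move=> u; rewrite DE; apply: (dvdX_comp_part c_closed).
  by rewrite sumA; have /mulmx_gaug := rowker l; under eq_bigr do rewrite mxE.
(* Row p of B0 A0 differs from the unit vector p by a constant syzygy, whose
component part has degree n - 2 < n and so is zero. *)
have DB p : e p.1 p.2 ->
    D (fun k => (B0 p k)%:MP) = if c p.1 then edge_mon p.1 p.2 else 0.
  move=> ep; pose a1 q : S := \sum_k (B0 p k)%:MP * (A0 k q)%:MP - (q == p)%:R.
  have DaE : comp_part c a1 =
      D (fun k => (B0 p k)%:MP) - (if c p.1 then edge_mon p.1 p.2 else 0).
    rewrite DE /comp_part /a1; under eq_bigr do rewrite mulrBl.
    rewrite sumrB; congr (_ - _); case: ifPn => cp.
      rewrite (bigD1 p) ?ep //= eqxx mul1r big1 ?addr0 //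
        => q /andP[_ /negbTE ->].
      by rewrite mul0r.
    rewrite big1 // => q /andP[_ cq]; case: eqP => [qp|]; last by rewrite mul0r.
    by rewrite -qp cq in cp.
  apply/eqP; rewrite -subr_eq0 -DaE; apply/eqP/(@homog_dvdX_eq0 _ _ (n - 2)).
  - rewrite DaE rpredB //; last first.
      by case: ifP => _; [apply: hgen | apply: rpred0].
    by apply: rpred_sum => k _; rewrite mul_mpolyC; apply/dhomogZ/hDA.
  - by rewrite ltn_subrL (ltnW n_gt1).
  move=> u; apply: (dvdX_comp_part c_closed).
  under eq_bigr do rewrite mulrBl.
  rewrite sumrB sumA [X in _ - X](_ : _ = edge_mon p.1 p.2); last first.
    rewrite (bigD1 p) //= eqxx mul1r big1 ?addr0 // => q /andP[_ /negbTE ->].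
    by rewrite mul0r.
  apply/eqP; rewrite (gB p ep) subr_eq0; apply/eqP/eq_bigr => k _.
  by rewrite mul_mpolyC.
(* A relation between two edge monomials, rewritten by B0 as a syzygy of the
given generators, is a combination of the rows of gdiff 0. *)
have kerB (x y : S) p q : e p.1 p.2 -> e q.1 q.2 ->
    x * edge_mon p.1 p.2 = y * edge_mon q.1 q.2 ->
    exists w : 'rV_(grank F 1), forall k,
    x * (B0 p k)%:MP - y * (B0 q k)%:MP = \sum_l w 0 l * gdiff F 0 l k.
  move=> ep eq xy.
  have /res0[w wE] :
      (\row_k (x * (B0 p k)%:MP - y * (B0 q k)%:MP)) *m gaug F = 0.
    apply/mulmx_gaug; under eq_bigr do rewrite mxE mulrBl -!mulrA.
    rewrite sumrB -!big_distrr /=; under eq_bigr do rewrite mul_mpolyC.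
    rewrite -(gB p ep); under eq_bigr do rewrite mul_mpolyC.
    by rewrite -(gB q eq) xy subrr.
  exists w => k; have := congr1 (fun M : 'rV_ _ => M 0 k) wE.
  by rewrite !mxE.
(* D equals X on the relation between the edges in different components. *)
have [l ln] : exists l : 'I_(grank F 1), (n <= gshift l)%N.
  have [|w wE] := @kerB ('X_i * 'X_i') ('X_j * 'X_j') (i, i') (j, j') eii' ejj'.
    by rewrite -!mulrA !X_edge_mon ?dart_neq // !X_vertex_mon.
  have Dw : D (fun k => \sum_l w 0 l * gdiff F 0 l k) = all_mon n K.
    rewrite /D; under eq_bigr do rewrite -wE mulrBl -!mulrA.
    rewrite sumrB -!big_distrr /= -/(D _) -/(D (fun k => (B0 (j, j') k)%:MP))
      !DB //=.
    rewrite /c connect0 (negbTE ncij) !mulr0 subr0.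
    by rewrite X_edge_mon ?dart_neq // X_vertex_mon.
  apply/existsP; apply: contraT; rewrite negb_exists => /forallP small.
  have /eqP[] := all_mon_neq0 n K; rewrite -Dw /D.
  under eq_bigr do rewrite big_distrl /=.
  rewrite exchange_big /= big1 // => l _.
  under eq_bigr do rewrite -mulrA.
  by rewrite -big_distrr /= -/(D _) Drow ?mulr0 // ltnNge.
(* The coefficient of x_a in the relation between va and vb is a nonzero vector
of constants, which needs a row of gdiff 0 of degree at most one. *)
have [l' l'n] : exists l : 'I_(grank F 1), (gshift l < n)%N.
  have [|w wE] := @kerB 'X_a 'X_b (v, a) (v, b) eva evb.
    by rewrite /= !X_edge_mon ?dart_neq.
  have [k Bk] : exists k, B0 (v, a) k != 0.
    apply/existsP; apply: contraT; rewrite negb_exists => /forallP B00.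
    have /eqP[] := edge_mon_neq0 K v a; rewrite (gB (v, a) eva) big1 // => k _.
    by have := B00 k; rewrite negbK => /eqP ->; rewrite scale0r.
  have [l2 _] : exists2 l, true & (w 0 l * gdiff F 0 l k)@_U_(a) != 0.
    apply: exN0; rewrite -wE mcoeffB ![_ * _%:MP]mulrC !mcoeffCM !mcoeffXU eqxx.
    by rewrite (eq_sym b) (negbTE ab) mulr0 subr0 mulr1.
  have := gdiffH 0%N l2 k; rewrite /homog_entry shift0;
    case: leqP => [le hd|_ ->].
    move/(coeffM_homog hd); rewrite mdeg1 => le1; exists l2.
    by rewrite -(subnK le) -[X in (_ < X)%N](subnK n_gt1) addnC ltn_add2l ltnS.
  by rewrite mulr0 mcoeff0 eqxx.
by move: l'n; rewrite (shiftE _ l' l) ltnNge ln.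
Qed.

End Ideal.

(** * Resolutions of length two with constant bases *)

Section FreeKernel.
Variables (n : nat) (K : fieldType).
Local Notation S := {mpoly K[n]}.
Local Notation toS := (map_mx (@mpolyC n K)).

(** S is flat over K: the kernel over S of a matrix M over K is spanned by any
basis B of its kernel over K. Concretely, 1 - M M^+ has its rows in the kernel,
M^+ being a generalized inverse of M, so v M = 0 gives v = v (1 - M M^+). *)
Lemma constant_kernel m p (M : 'M[K]_(m, p)) :
  exists r (B : 'M[K]_(r, m)) (Q : 'M[K]_(m, r)),
  [/\ B *m Q = 1%:M, B *m M = 0
    & forall v : 'rV[S]_m, v *m toS M = 0 -> v = v *m toS Q *m toS B].
Proof.
pose B := row_base (kermx M).
have fB : row_free B by apply: row_base_free.
have BQ : B *m pinvmx B = 1%:M by rewrite mulmxVp.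
exists (\rank (kermx M)), B, (pinvmx B); split=> //.
  by apply/sub_kermxP; rewrite eq_row_base.
move=> v vM0; set P := 1%:M - M *m pinvmx M.
have vP : v = v *m toS P.
  rewrite map_mxB map_mxM map_mx1 mulmxBr mulmx1 mulmxA vM0 mul0mx subr0 //.
have /submxP[Q' PQ] : (P <= B)%MS.
  rewrite eq_row_base; apply/sub_kermxP.
  by rewrite mulmxBl mul1mx mulmxKpV ?subrr.
by rewrite [in RHS]vP {1}vP PQ -!mulmxA -!map_mxM /= mulmxA -(mulmxA Q') BQ
  mulmx1.
Qed.

End FreeKernel.

Section Length2.
Variables (n : nat) (K : fieldType).
Local Notation S := {mpoly K[n]}.

(** The shifts are s in step 0, da + s in step 1 and db + (da + s) in step 2.
Minimality holds because da and db are positive. *)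
Lemma pure_of_length2 (I : S -> Prop) r0 r1 r2 (g : 'cV[S]_r0)
    (d0 : 'M[S]_(r1, r0)) (d1 : 'M[S]_(r2, r1)) (s da db : nat) :
    (0 < da)%N -> (0 < db)%N ->
    (forall k, g k 0 \is s.-homog) -> (forall k l, d0 k l \is da.-homog) ->
    (forall k l, d1 k l \is db.-homog) ->
    (forall f, I f <-> exists v : 'rV_r0, f = (v *m g) 0 0) ->
    (forall v : 'rV_r0, v *m g = 0 <-> exists w, v = w *m d0) ->
    (forall v : 'rV_r1, v *m d0 = 0 <-> exists w, v = w *m d1) ->
    (forall v : 'rV_r2, v *m d1 = 0 -> v = 0) ->
  has_pure_resolution I.
Proof.
move=> da0 db0 hg hd0 hd1 hI ex0 ex1 ex2.
pose rk i := match i with 0 => r0 | 1 => r1 | 2 => r2 | _ => 0 end%N.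
pose d i : 'M[S]_(rk i.+1, rk i) :=
  match i return 'M[S]_(rk i.+1, rk i) with 0%N => d0 | 1%N => d1 | _ => 0 end.
pose sh i := match i with 0 => s | 1 => da + s | _ => db + (da + s) end%N.
exists (@GradedFreeSeq n K rk (fun i _ => sh i) d g).
split; last first.
  move=> i j j'; rewrite /betti -!lt0n => /card_gt0P[k]; rewrite inE => /eqP <-.
  by case/card_gt0P=> k'; rewrite inE => /eqP.
split; first split=> /=.
- by move=> k; rewrite /homog_entry leq0n subn0.
- case=> [|[|i]] k l; rewrite /homog_entry /=.
  + by rewrite leq_addl addnK.
  + by rewrite leq_addl addnK.
  + by case: k.
- split=> //= -[|[|i]] v /=.
  + exact: ex1.
  + split=> [/ex2 ->|[w ->]]; last by rewrite [w]thinmx0 !mul0mx.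
    by exists 0; rewrite mul0mx.
  + split=> _; last by rewrite [v]thinmx0 mul0mx.
    by exists 0; rewrite [v]thinmx0 mul0mx.
case=> [|[|i]] k l /=.
- exact: homog_coeff0 (hd0 k l) da0.
- exact: homog_coeff0 (hd1 k l) db0.
- by case: k.
Qed.

Section ConstBasis.
Variables (D : finType) (r : nat).

Definition lincomb (B : 'I_r -> D -> K) (w : 'rV[S]_r) (p : D) : S :=
  \sum_k w 0 k * (B k p)%:MP.
Definition coords (Q : D -> 'I_r -> K) (z : D -> S) : 'rV[S]_r :=
  \row_k \sum_p z p * (Q p k)%:MP.

(** [B] is a family of K-valued functions whose S-span is [L], freely, and [Q]
gives the coordinates by K-linear forms; thus a matrix entry built from [B] and
[Q] with linear coefficients is homogeneous. *)
Definition const_basis (L : (D -> S) -> Prop) B Q :=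
  [/\ forall w, L (lincomb B w), forall w, coords Q (lincomb B w) = w
    & forall z, L z -> lincomb B (coords Q z) =1 z].
End ConstBasis.

(** The equations form a matrix over K, indexed by enumerations of [D] and [J],
to which [constant_kernel] applies. *)
Lemma const_basisP (D J : finType) (M : D -> J -> K) (L : (D -> S) -> Prop) :
    (forall z, L z <-> forall j, \sum_p z p * (M p j)%:MP = 0) ->
  exists r (B : 'I_r -> D -> K) Q, const_basis L B Q.
Proof.
move=> LP; pose M' := \matrix_(p < #|D|, j < #|J|) M (enum_val p) (enum_val j).
have [r [B [Q [BQ BM MK]]]] := constant_kernel n M'.
have sumD (f : D -> S) : \sum_p f p = \sum_(k < #|D|) f (enum_val k).
  by rewrite (reindex (@enum_val D predT)) //=; apply/onW_bij/enum_val_bij.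
pose B' k p := B k (enum_rank p); pose Q' p k := Q (enum_rank p) k.
exists r, B', Q'.
pose row (z : D -> S) : 'rV_#|D| := \row_k z (enum_val k).
have rowL w : row (lincomb B' w) = w *m map_mx (@mpolyC n K) B.
  by apply/rowP => k; rewrite !mxE; apply: eq_bigr => l _;
    rewrite /B' enum_valK !mxE.
have coE z : coords Q' z = row z *m map_mx (@mpolyC n K) Q.
  apply/rowP => k; rewrite !mxE sumD; apply: eq_bigr => l _.
  by rewrite /Q' enum_valK !mxE.
have LM z : L z <-> row z *m map_mx (@mpolyC n K) M' = 0.
  split=> [/LP zM|zM].
    apply/rowP => j; rewrite !mxE -[RHS](zM (enum_val j)) sumD.
    by apply: eq_bigr => k _; rewrite !mxE.
  apply/LP => j; have := congr1 (fun A : 'rV_ _ => A 0 (enum_rank j)) zM.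
  rewrite !mxE sumD => zMj; rewrite -[RHS]zMj.
  by apply: eq_bigr => k _; rewrite !mxE enum_rankK.
split=> [w|w|z /LM/MK zE].
- by apply/LM; rewrite rowL -mulmxA -map_mxM BM map_mx0 mulmx0.
- by rewrite coE rowL -mulmxA -map_mxM BQ map_mx1 mulmx1.
move=> p.
have := congr1 (fun A : 'rV_ _ => A 0 (enum_rank p)) (rowL (coords Q' z)).
by rewrite coE -zE !mxE enum_rankK.
Qed.

End Length2.

(** * Edges, darts and disjoint unions of edges *)

Section EdgesAndDarts.
Variables (n : nat) (K : fieldType) (e : rel 'I_n).
Local Notation S := {mpoly K[n]}.
Local Notation edge_mon := (edge_mon K).
Local Notation vertex_mon := (vertex_mon K).
Local Notation dart := ('I_n * 'I_n)%type.
Hypothesis e_sym : symmetric e.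
Hypothesis e_irr : irreflexive e.

Definition swap (p : dart) : dart := (p.2, p.1).
Lemma swapK : involutive swap. Proof. by case. Qed.
Lemma e_swap p : e (swap p).1 (swap p).2 = e p.1 p.2. Proof. exact: e_sym. Qed.

(** One dart for each undirected edge, since a minimal system of generators
must list each monomial once. *)
Definition edge (p : dart) : bool := (p.1 < p.2)%N && e p.1 p.2.

Lemma dart_edge p : e p.1 p.2 = edge p || edge (swap p).
Proof.
rewrite /edge e_swap -andb_orl -neq_ltn; apply/esym/andb_idl => ep.
exact: dart_neq ep.
Qed.

Lemma edge_swapF p : edge p -> edge (swap p) = false.
Proof. by case/andP=> p12 _; rewrite /edge /= ltnNge ltnW. Qed.

Lemma sum_darts (V : nmodType) (f : dart -> V) :
  \sum_(p | e p.1 p.2) f p = \sum_(p | edge p) (f p + f (swap p)).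
Proof.
rewrite (bigID (fun p : dart => p.1 < p.2)%N) big_split /=; congr (_ + _).
  by apply: eq_bigl => p; rewrite andbC.
rewrite (reindex_inj (inv_inj swapK)); apply: eq_bigl => p.
rewrite e_swap /edge andbC -leqNgt leq_eqVlt andb_orl /=.
by case: eqP => //= /val_inj p12; rewrite p12 e_irr !andbF.
Qed.

(** The generators as a column indexed by the enumeration of the edges; rows of
the same length are treated below as functions on darts, of which only the
values on edges matter. *)
Definition gens : 'cV[S]_#|edge| :=
  \col_k edge_mon (enum_val k).1 (enum_val k).2.

Lemma edgeP (k : 'I_#|edge|) : edge (enum_val k).
Proof. exact: (enum_valP k). Qed.

Lemma row_mul_gens (s : dart -> S) :
  ((\row_(k < #|edge|) s (enum_val k)) *m gens) 0 0 =
    \sum_(p | edge p) s p * edge_mon p.1 p.2.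
Proof.
rewrite mxE (big_enum_val (fun p => s p * edge_mon p.1 p.2)).
by apply: eq_bigr => k _; rewrite !mxE.
Qed.

Lemma row_edge_fun (v : 'rV[S]_#|edge|) : exists s, v = \row_k s (enum_val k).
Proof.
exists (fun p => \sum_(k | enum_val k == p) v 0 k); apply/rowP => k;
  rewrite mxE.
by rewrite (big_pred1 k) // => l; rewrite (inj_eq enum_val_inj).
Qed.

Lemma ideal_gens f : complementary_edge_ideal K e f <->
  exists v : 'rV_#|edge|, f = (v *m gens) 0 0.
Proof.
split=> [/edge_idealP[s ->]|[v ->]].
  exists (\row_k (s (enum_val k) + s (swap (enum_val k)))).
  rewrite (row_mul_gens (fun p => s p + s (swap p))) sum_darts;
    apply: eq_bigr => p _.
  by rewrite [edge_mon (swap p).1 _]edge_monC mulrDl.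
have [s ->] := row_edge_fun v; rewrite row_mul_gens.
apply/edge_idealP; exists (fun p => if edge p then s p else 0).
rewrite sum_darts; apply: eq_bigr => p pe.
by rewrite pe edge_swapF // mul0r addr0.
Qed.

Lemma gens_syzygyP (v : 'rV[S]_#|edge|) s : v = \row_k s (enum_val k) ->
  v *m gens = 0 <-> \sum_(p | edge p) s p * edge_mon p.1 p.2 = 0.
Proof.
move=> ->; rewrite -row_mul_gens; split=> [->|h]; first by rewrite mxE.
by apply/matrixP => i j; rewrite !ord1 h mxE.
Qed.

Lemma homog_gens (k : 'I_#|edge|) : gens k 0 \is (n - 2).-homog.
Proof. by rewrite mxE; apply: homog_edge_mon;
  have /andP[_ /dart_neq] := edgeP k; apply. Qed.

Lemma sum_indicator (P : pred dart) (z : dart -> S) :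
  \sum_p z p * ((P p)%:R : K)%:MP = \sum_(p | P p) z p.
Proof.
rewrite [RHS]big_mkcond; apply: eq_bigr => p _.
by case: (P p); rewrite ?mpolyC1 ?mulr1 // mpolyC0 mulr0.
Qed.

Lemma mulX_inj v (x y : S) : 'X_v * x = 'X_v * y -> x = y.
Proof. by apply: mulfI; apply: X_neq0. Qed.

Section Matching.
Hypothesis matching : forall i j k, e i j -> e i k -> j = k.

Definition sum0 (z : dart -> S) : Prop :=
  (forall p, ~~ edge p -> z p = 0) /\ \sum_p z p = 0.

Lemma sum0_basis : exists r (B : 'I_r -> dart -> K) Q, const_basis sum0 B Q.
Proof.
apply: (@const_basisP n K _ (option dart)
  (fun p j => if j is Some q then ((p == q) && ~~ edge q)%:R else true%:R)).
move=> z; split=> [[zE z0] [q|]|h].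
- rewrite (sum_indicator (fun p => (p == q) && ~~ edge q));
  case: (boolP (edge q)) => qe.
    by rewrite big1 // => p; rewrite andbF.
  by rewrite big1 // => p; rewrite andbT => /eqP ->; apply: zE.
- by rewrite (sum_indicator (fun p => true)).
split=> [p pe|]; last by have := h None;
  rewrite (sum_indicator (fun p => true)).
have := h (Some p); rewrite (sum_indicator (fun q => (q == p) && ~~ edge p)).
by rewrite (big_pred1 p) // => q; rewrite pe andbT.
Qed.

Lemma matching_edge v p q : edge p -> edge q ->
  (v == p.1) || (v == p.2) -> (v == q.1) || (v == q.2) -> p = q.
Proof.
case: p q => [p1 p2] [q1 q2] /andP[/= p12 ep] /andP[/= q12 eq].
case/orP=> /eqP E1; case/orP=> /eqP E2; move: ep eq; rewrite -E1 -E2.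
- by move=> ep /(matching ep) ->.
- rewrite [e q1 _]e_sym => ep /(matching ep) E.
  by move: q12 p12; rewrite -E -E1 -E2 ltnNge => /negP h /ltnW.
- rewrite [e p1 _]e_sym => ep /(matching ep) E.
  by move: q12 p12; rewrite E -E1 -E2 ltnNge => /negP h /ltnW.
- by rewrite [e p1 _]e_sym [e q1 _]e_sym => ep /(matching ep) ->.
Qed.

(** In a matching, every generator other than that of [p] is divisible by both
variables of [p], so setting either of them to zero isolates the entry at
[p]. *)
Lemma matching_dvd (s : dart -> S) p : edge p ->
  \sum_(q | edge q) s q * edge_mon q.1 q.2 = 0 ->
    exists c, s p = 'X_p.1 * ('X_p.2 * c).
Proof.
move=> pe s0.
have kill_s v : (v == p.1) || (v == p.2) -> kill v (s p) = 0.
  move=> vp; have := congr1 (kill v) s0.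
  rewrite raddf0 raddf_sum (bigD1 p) //= rmorphM /= kill_edge_mon vp big1
    ?addr0.
    by move/eqP; rewrite mulf_eq0 (negbTE (edge_mon_neq0 _ _ _)) orbF => /eqP.
  move=> q /andP[qe qp]; rewrite rmorphM /= kill_edge_mon; case: ifP => vq;
    last by rewrite mulr0.
  by rewrite (matching_edge pe qe vp vq) eqxx in qp.
have [|c1 sE] := @kill_eq0 _ _ p.1 (s p); first by rewrite kill_s ?eqxx.
have p12 : p.2 != p.1 by case/andP: pe => _ /dart_neq -/(_ e_irr);
  rewrite eq_sym.
have [|c cE] := @kill_eq0 _ _ p.2 c1; last by exists c; rewrite sE cE.
have := kill_s p.2; rewrite eqxx orbT sE rmorphM /= killX eq_sym (negbTE p12).
by move/(_ isT)/eqP; rewrite mulf_eq0 (negbTE (X_neq0 _ _)) => /eqP.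
Qed.

Lemma XX_edge_mon p : edge p ->
  'X_p.1 * ('X_p.2 * edge_mon p.1 p.2) = all_mon n K.
Proof. by case/andP=> _ /dart_neq-/(_ e_irr) p12;
  rewrite X_edge_mon // X_vertex_mon. Qed.

(** A function c of sum zero gives the syzygy with entries x_i x_j c_ij. This
map is injective, so the resolution stops there. *)
Theorem matching_pure : has_pure_resolution (complementary_edge_ideal K e).
Proof.
have [r [B [Q [zL coz zco]]]] := sum0_basis.
pose d0 : 'M[S]_(r, #|edge|) := \matrix_(l, k)
  (B l (enum_val k) *: ('X_(enum_val k).1 * 'X_(enum_val k).2)).
have d0E w : w *m d0 = \row_k ('X_(enum_val k).1 * ('X_(enum_val k).2 *
    lincomb B w (enum_val k))).
  apply/rowP => k; rewrite !mxE mulrA big_distrr; apply: eq_bigr => l _ /=.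
  by rewrite mxE -mul_mpolyC mulrCA mulrA [RHS]mulrC [w 0 l * _]mulrC mulrA
    mulrC.
(* The second differential has no entries, so its degree 1 is arbitrary. *)
apply: (@pure_of_length2 n K _ #|edge| r 0 gens d0 0 (n - 2) 2 1) => //.
- exact: homog_gens.
- move=> l k; rewrite mxE; apply: dhomogZ.
  by rewrite -[2%N]/(1 + 1)%N; apply: dhomogM; apply: homog_X.
- by case.
- exact: ideal_gens.
- move=> v; split=> [|[w ->]]; last first.
    apply/(gens_syzygyP (s := fun p => 'X_p.1 * ('X_p.2 * lincomb B w p)));
      first exact: d0E.
    have [zE z0] := zL w;
      rewrite -[RHS](mul0r (all_mon n K)) -[in RHS]z0 big_distrl /=.
    rewrite [RHS](bigID edge) /= [X in _ = _ + X]big1 ?addr0.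
      by apply: eq_bigr => p pe; rewrite -(XX_edge_mon pe); ring.
    by move=> p /zE ->; rewrite mul0r.
  have [s sE] := row_edge_fun v => /(gens_syzygyP sE) s0.
  have /fin_all_exists[c cE] p : exists c, edge p ->
    s p = 'X_p.1 * ('X_p.2 * c).
    case: (boolP (edge p)) => [pe|]; last by exists 0.
    by have [c] := matching_dvd pe s0; exists c.
  pose z p := if edge p then c p else 0.
  have zz : sum0 z.
    split=> [p pe|]; first by rewrite /z (negbTE pe).
    rewrite -big_mkcond; apply/(mulIf (all_mon_neq0 n K));
      rewrite mul0r -[RHS]s0 big_distrl.
    by apply: eq_bigr => p pe /=; rewrite (cE p pe) -(XX_edge_mon pe); ring.
  exists (coords Q z); rewrite d0E sE; apply/rowP => k; rewrite !mxE.
  by rewrite (zco z zz) /z edgeP cE ?edgeP.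
- move=> w; split=> [|[u ->]]; last by rewrite [u]thinmx0 !mul0mx.
  rewrite d0E => w0; exists 0; rewrite mul0mx -[w]coz; apply/rowP => k.
  rewrite !mxE big1 // => p _; case: (boolP (edge p)) => pe; last first.
    by have [zE _] := zL w; rewrite zE // mul0r.
  have := congr1 (fun A : 'rV_ _ => A 0 (enum_rank_in pe p)) w0.
  rewrite !mxE enum_rankK_in // => /eqP;
    rewrite !mulf_eq0 !(negbTE (X_neq0 _ _)) /= => /eqP ->.
  by rewrite mul0r.
- by move=> v _; rewrite [v]thinmx0.
Qed.

End Matching.
End EdgesAndDarts.

(** * Connected graphs *)

Section ConnectedGraph.
Variables (n : nat) (K : fieldType) (e : rel 'I_n).
Local Notation S := {mpoly K[n]}.
Local Notation edge_mon := (edge_mon K).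
Local Notation vertex_mon := (vertex_mon K).
Local Notation gens := (gens K e).
Local Notation edge := (edge e).
Local Notation dart := ('I_n * 'I_n)%type.
Hypothesis e_sym : symmetric e.
Hypothesis e_irr : irreflexive e.

(** The functions that are [divfree] index the linear syzygies, as the products
x_j X / (x_i x_j) around a vertex i coincide. The space of circulations is the
cycle space of the graph. *)
Definition div (z : dart -> S) (v : 'I_n) : S := \sum_(p | p.1 == v) z p.

Definition supported (z : dart -> S) : Prop :=
  forall p, ~~ e p.1 p.2 -> z p = 0.
Definition antisym (z : dart -> S) : Prop := forall p, z p + z (swap p) = 0.

Definition divfree z : Prop := supported z /\ div z =1 fun=> 0.
Definition circulation z : Prop := divfree z /\ antisym z.

Definition flow (b : 'I_n -> S) z : Prop :=
  [/\ supported z, antisym z & div z =1 b].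

Lemma flow_add b c y z : flow b y -> flow c z ->
  flow (fun v => b v + c v) (fun p => y p + z p).
Proof.
move=> [ys ya yd] [zs za zd]; split=> [p pe|p|v].
- by rewrite ys ?zs ?addr0.
- by rewrite addrACA ya za addr0.
- by rewrite /div big_split /= -yd -zd.
Qed.

Lemma flow_ext b c z : flow b z -> b =1 c -> flow c z.
Proof. by move=> [zs za zd] bc; split=> // v; rewrite zd bc. Qed.

Lemma flow0 : flow (fun=> 0) (fun=> 0).
Proof. by split=> [//|p|v]; rewrite ?addr0 // /div big1. Qed.

Lemma div_delta (q : dart) v : div (fun p => (p == q)%:R) v = (v == q.1)%:R.
Proof.
rewrite /div; have [->|vq] := eqVneq v q.1.
  by rewrite (bigD1 q) //= eqxx big1 ?addr0 // => p /andP[_ /negbTE ->].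
rewrite big1 // => p /eqP pv; case: eqP => // pq.
by rewrite -pv pq eqxx in vq.
Qed.

Lemma flow_edge x y : e x y ->
  exists z, flow (fun v => (v == x)%:R - (v == y)%:R) z.
Proof.
move=> exy; exists (fun p => (p == (x, y))%:R - (p == (y, x))%:R);
  split=> [p pe|p|v].
- have /negbTE -> : p != (x, y) by apply: contraNneq pe => ->.
  have /negbTE -> : p != (y, x) by apply: contraNneq pe => -> /=; rewrite e_sym.
  by rewrite subrr.
- have sE a b : (swap p == (a, b)) = (p == (b, a)).
    by rewrite -(inj_eq (inv_inj (@swapK n))) swapK.
  by rewrite !sE addrC subrKA subrr.
by rewrite /div sumrB -!/(div _ _) !div_delta.
Qed.

Lemma flow_connect x y : connect e x y ->
  exists z, flow (fun v => (v == x)%:R - (v == y)%:R) z.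
Proof.
case/connectP => p; elim: p x => [|x' p IH] x /= => [_ ->|/andP[exx' px'] yE].
  by exists (fun=> 0); apply: flow_ext flow0 _ => v; rewrite subrr.
have [z1 f1] := flow_edge exx'; have [z2 f2] := IH _ px' yE.
by eexists; apply: flow_ext (flow_add f1 f2) _ => v; rewrite addrA subrK.
Qed.

(** Route b_x from every vertex x to one root; what arrives there is the total
of b, which is zero. *)
Lemma flow_exists b : graph_connected e -> \sum_v b v = 0 -> exists z, flow b z.
Proof.
case: (pickP 'I_n) => [r _ conn b0|no_vertex _ _]; last first.
  by exists (fun=> 0); apply: flow_ext flow0 _ => v; have := no_vertex v.
have /fin_all_exists[z zP] x := flow_connect (conn x r).
exists (fun p => \sum_x b x * z x p); split=> [p pe|p|v].
- by rewrite big1 // => x _; have [zs _ _] := zP x; rewrite zs ?mulr0.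
- rewrite -big_split big1 // => x _ /=; have [_ za _] := zP x.
  by rewrite -mulrDr za mulr0.
rewrite /div exchange_big /=.
under eq_bigr => x _ do rewrite -big_distrr -/(div (z x) v) /=.
have -> : \sum_x b x * div (z x) v =
  \sum_x (b x * (v == x)%:R - b x * (v == r)%:R).
  by apply: eq_bigr => x _; have [_ _ ->] := zP x; rewrite mulrBr.
rewrite sumrB -big_distrl b0 /= mul0r subr0 (bigD1 v) //= eqxx mulr1 big1
  ?addr0 // => x xv.
by rewrite eq_sym (negbTE xv) mulr0.
Qed.

Lemma X_edge_monl p : e p.1 p.2 -> 'X_p.2 * edge_mon p.1 p.2 = vertex_mon p.1.
Proof. by move/(dart_neq e_irr)=> p12; rewrite X_edge_mon. Qed.
Lemma X_edge_monr p : e p.1 p.2 -> 'X_p.1 * edge_mon p.1 p.2 = vertex_mon p.2.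
Proof. by move/(dart_neq e_irr)=> p12;
  rewrite edge_monC X_edge_mon // eq_sym. Qed.

(** The products x_j X / (x_i x_j) over the neighbours j of i all equal X / x_i,
so their coefficients add up to the divergence of a at i. *)
Lemma sum_div_vertex_mon a : supported a ->
  \sum_(p | edge p) ('X_p.2 * a p + 'X_p.1 * a (swap p)) * edge_mon p.1 p.2
  = \sum_v div a v * vertex_mon v.
Proof.
move=> a0; transitivity (\sum_p a p * vertex_mon p.1).
  rewrite [RHS](bigID (fun p => e p.1 p.2)) /= [X in _ = _ + X]big1 ?addr0;
    last first.
    by move=> p /a0 ->; rewrite mul0r.
  rewrite (sum_darts e_sym e_irr) /=; apply: eq_bigr => p /andP[_ pe].
  by rewrite -(X_edge_monl pe) -(X_edge_monr pe); ring.
rewrite (partition_big fst predT) //=; apply: eq_bigr => v _.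
by rewrite /div big_distrl /=; apply: eq_bigr => p /eqP ->.
Qed.

(** X / x_v is the only one of these monomials that survives when x_v is set
to zero. *)
Lemma vertex_mon_syzygy (A : 'I_n -> S) : \sum_v A v * vertex_mon v = 0 ->
  exists2 b, forall v, A v = 'X_v * b v & \sum_v b v = 0.
Proof.
move=> A0; have /fin_all_exists[b bE] v : exists q, A v = 'X_v * q.
  apply: kill_eq0; have := congr1 (kill v) A0.
  rewrite raddf0 raddf_sum (bigD1 v) //= rmorphM /= kill_vertex_mon eqxx big1
    ?addr0.
    by move/eqP; rewrite mulf_eq0 (negbTE (vertex_mon_neq0 _ _)) orbF => /eqP.
  by move=> u uv; rewrite rmorphM /= kill_vertex_mon eq_sym (negbTE uv) mulr0.
exists b => //; apply: (mulIf (all_mon_neq0 n K));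
  rewrite mul0r -[RHS]A0 big_distrl.
by apply: eq_bigr => v _ /=; rewrite bE -(X_vertex_mon K v); ring.
Qed.

Lemma edge_eq p q : edge p -> edge q ->
  (p.1 == q.1) || (p.1 == q.2) -> (p.2 == q.1) || (p.2 == q.2) -> p = q.
Proof.
case: p q => [p1 p2] [q1 q2] /andP[/= p12 _] /andP[/= q12 _].
case/orP=> /eqP E1; case/orP=> /eqP E2; move: p12 q12; rewrite E1 E2 ?ltnn //.
by move=> h /ltnW; rewrite leqNgt h.
Qed.

(** When the variables of both ends of [p] are set to zero, the generator of [p]
survives and all the others vanish, so the entry at [p] must vanish. *)
Lemma syzygy_entry (s : dart -> S) p : edge p ->
    \sum_(q | edge q) s q * edge_mon q.1 q.2 = 0 ->
  exists a, s p = 'X_p.2 * a.1 + 'X_p.1 * a.2.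
Proof.
move=> pe s0; have [|q qE] := @kill_eq0 _ _ p.1 (kill p.2 (s p)).
  have := congr1 (fun f => kill p.1 (kill p.2 f)) s0.
  rewrite !raddf0 !kill_sum (bigD1 p) //= !rmorphM /=.
  rewrite !(kill_edge_mon, eqxx, orbT) /= big1 ?addr0.
    by move/eqP; rewrite mulf_eq0 (negbTE (edge_mon_neq0 _ _ _)) orbF => /eqP.
  move=> q /andP[qe qp]; rewrite !rmorphM /= kill_edge_mon.
  case: ifP => q2; last by rewrite raddf0 mulr0.
  rewrite kill_edge_mon; case: ifP => q1; last by rewrite mulr0.
  by rewrite (edge_eq pe qe q1 q2) eqxx in qp.
have [q' sE] := kill_split p.2 (s p).
by exists (q', q); rewrite sE qE addrC.
Qed.

(** The entries split as in [syzygy_entry], into functions whose divergence is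
x_v b_v with b of total zero; subtracting x_v times a flow of divergence b
makes it zero and does not change the entries, as the flow is antisymmetric. *)
Lemma syzygy_lift (s : dart -> S) : graph_connected e ->
    \sum_(p | edge p) s p * edge_mon p.1 p.2 = 0 ->
  exists2 z, divfree z & forall p, edge p ->
    s p = 'X_p.2 * z p + 'X_p.1 * z (swap p).
Proof.
move=> conn s0.
have /fin_all_exists[a' a'E] p : exists a, edge p ->
    s p = 'X_p.2 * a.1 + 'X_p.1 * a.2.
  case: (boolP (edge p)) => [pe|]; last by exists (0, 0).
  by have [a] := syzygy_entry pe s0; exists a.
pose a p := if edge p then (a' p).1 else if edge (swap p) then (a' (swap p)).2
  else 0.
have as0 : supported a.
  move=> p; rewrite (dart_edge e_sym e_irr) negb_or /a.
  by case/andP=> /negbTE -> /negbTE ->.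
have aE p : edge p -> s p = 'X_p.2 * a p + 'X_p.1 * a (swap p).
  by move=> pe; rewrite /a (edge_swapF pe) swapK pe a'E.
have [|b aX b0] := @vertex_mon_syzygy (div a).
  by rewrite -sum_div_vertex_mon // -[RHS]s0; apply: eq_bigr => p /aE ->.
have [f [fs fa fd]] := flow_exists conn b0.
exists (fun p => a p - 'X_p.1 * f p); first split=> [p pe|v].
- by rewrite as0 // fs // mulr0 subr0.
- rewrite /div sumrB -/(div a v) aX -fd /div big_distrr -sumrB big1 //
  => p /eqP <-.
  by rewrite subrr.
move=> p /aE ->; have /eqP := fa p; rewrite addrC addr_eq0 => /eqP /= ->; ring.
Qed.

Lemma divfree_basis :
  exists r (B : 'I_r -> dart -> K) Q, const_basis divfree B Q.
Proof.
apply: (@const_basisP n K _ ('I_n + dart)%type (fun p j => match j with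
  | inl v => (p.1 == v)%:R | inr q => ((p == q) && ~~ e q.1 q.2)%:R end)).
move=> z; split=> [[zs z0] [v|q]|h].
- by rewrite (sum_indicator (fun p => p.1 == v)); apply: z0.
- rewrite (sum_indicator (fun p => (p == q) && ~~ e q.1 q.2)) big1 //
  => p /andP[/eqP ->].
  exact: zs.
split=> [q qe|v]; last by have := h (inl v);
  rewrite (sum_indicator (fun p => p.1 == v)).
have := h (inr q); rewrite (sum_indicator (fun p => (p == q) && ~~ e q.1 q.2)).
by rewrite (big_pred1 q) // => p; rewrite qe andbT.
Qed.

Lemma circulation_basis :
  exists r (B : 'I_r -> dart -> K) Q, const_basis circulation B Q.
Proof.
apply: (@const_basisP n K _ ('I_n + (dart + dart))%type (fun p j => match j with
  | inl v => (p.1 == v)%:R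
  | inr (inl q) => ((p == q) && ~~ e q.1 q.2)%:R
  | inr (inr q) => (p == q)%:R + (p == swap q)%:R end)).
have antiE (z : dart -> S) q :
    \sum_p z p * ((p == q)%:R + (p == swap q)%:R : K)%:MP = z q + z (swap q).
  under eq_bigr do rewrite mpolyCD mulrDr.
  rewrite big_split /= (sum_indicator (fun p => p == q)).
  rewrite (sum_indicator (fun p => p == swap q)).
  by rewrite !big_pred1_eq.
move=> z; split=> [[[zs z0] za] [v|[q|q]]|h].
- by rewrite (sum_indicator (fun p => p.1 == v)); apply: z0.
- rewrite (sum_indicator (fun p => (p == q) && ~~ e q.1 q.2)) big1 //
  => p /andP[/eqP ->].
  exact: zs.
- by rewrite antiE.
split=> [|q]; last by have := h (inr (inr q)); rewrite antiE.
split=> [q qe|v]; last by have := h (inl v);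
  rewrite (sum_indicator (fun p => p.1 == v)).
have := h (inr (inl q));
  rewrite (sum_indicator (fun p => (p == q) && ~~ e q.1 q.2)).
by rewrite (big_pred1 q) // => p; rewrite qe andbT.
Qed.

Lemma divfree_circulation y : circulation y -> divfree (fun p => 'X_p.1 * y p).
Proof.
move=> [[ys yd] _]; split=> [p pe|v]; first by rewrite ys ?mulr0.
rewrite /div (eq_bigr (fun p => 'X_v * y p)) => [|p /eqP -> //].
by rewrite -big_distrr -/(div y v) /= yd mulr0.
Qed.

(** From x_j z_ij = - x_i z_ji, x_i divides z_ij, and the quotients are
antisymmetric. *)
Lemma divfree_dvd z : divfree z ->
    (forall p, edge p -> 'X_p.2 * z p + 'X_p.1 * z (swap p) = 0) ->
  exists2 y, circulation y & forall p, z p = 'X_p.1 * y p.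
Proof.
move=> [zs zd] z0.
have {}z0 p : e p.1 p.2 -> 'X_p.2 * z p + 'X_p.1 * z (swap p) = 0.
  rewrite (dart_edge e_sym e_irr) => /orP[/z0 //|/z0].
  by rewrite swapK addrC.
have /fin_all_exists[y' y'E] p : exists y, z p = 'X_p.1 * y.
  case: (boolP (e p.1 p.2)) => pe; last by exists 0; rewrite zs ?mulr0.
  apply: kill_eq0; have := congr1 (kill p.1) (z0 p pe).
  rewrite raddf0 raddfD /= !rmorphM /= !killX eqxx mul0r addr0.
  rewrite eq_sym (negbTE (dart_neq e_irr pe)) => /eqP.
  by rewrite mulf_eq0 (negbTE (X_neq0 _ _)) => /eqP.
exists y' => //; split; first split=> [p pe|v].
- by apply: (@mulX_inj n K p.1); rewrite -y'E zs // mulr0.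
- apply: (@mulX_inj n K v); rewrite mulr0 -[RHS](zd v) /div big_distrr.
  by apply: eq_bigr => p /eqP <-; rewrite y'E.
move=> p; case: (boolP (e p.1 p.2)) => pe.
  apply: (@mulX_inj n K p.1); apply: (@mulX_inj n K p.2);
    rewrite !mulr0 -[RHS](z0 p pe) !y'E /=.
  ring.
have z0' q : ~~ e q.1 q.2 -> y' q = 0.
  by move=> qe; apply: (@mulX_inj n K q.1); rewrite -y'E zs // mulr0.
by rewrite !z0' ?addr0 ?e_swap.
Qed.

(** The steps are the generators in degree n - 2, the divergence-free functions
in degree n - 1 and the circulations in degree n; [d1] sends y to the function
x_i y_ij in its coordinates. *)
Theorem connected_pure : graph_connected e ->
  has_pure_resolution (complementary_edge_ideal K e).
Proof.
move=> conn.
have [r1 [B1 [Q1 [L1 co1 ev1]]]] := divfree_basis.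
have [r2 [B2 [Q2 [L2 co2 ev2]]]] := circulation_basis.
pose d0 : 'M[S]_(r1, #|edge|) := \matrix_(l, k)
  (B1 l (enum_val k) *: 'X_(enum_val k).2 + B1 l (swap (enum_val k)) *:
    'X_(enum_val k).1).
pose d1 : 'M[S]_(r2, r1) := \matrix_(l, k) \sum_p (B2 l p * Q1 p k) *: 'X_p.1.
pose lin w p : S := 'X_p.2 * lincomb B1 w p + 'X_p.1 * lincomb B1 w (swap p).
have d0E w : w *m d0 = \row_k lin w (enum_val k).
  apply/rowP => k; rewrite !mxE /lin !big_distrr -big_split;
    apply: eq_bigr => l _ /=.
  rewrite mxE -!mul_mpolyC; ring.
have d1E u : u *m d1 = coords Q1 (fun p => 'X_p.1 * lincomb B2 u p).
  apply/rowP => k; rewrite !mxE; under eq_bigr do rewrite mxE big_distrr /=.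
  rewrite exchange_big; apply: eq_bigr => p _ /=.
  rewrite big_distrr big_distrl; apply: eq_bigr => l _ /=.
  rewrite -mul_mpolyC mpolyCM; ring.
have homogX (c : K) v : c *: 'X_v \is 1.-homog by apply/dhomogZ/homog_X.
apply: (@pure_of_length2 n K _ #|edge| r1 r2 gens d0 d1 (n - 2) 1 1) => //.
- exact: homog_gens.
- by move=> l k; rewrite mxE; apply: rpredD; apply: homogX.
- by move=> l k; rewrite mxE; apply: rpred_sum => p _; apply: homogX.
- exact: ideal_gens.
- move=> v; split=> [|[w ->]].
    have [s sE] := row_edge_fun v.
    move=> /(gens_syzygyP sE)/(syzygy_lift conn)[z zz szE].
    exists (coords Q1 z); rewrite d0E sE; apply/rowP => k.
    by rewrite !mxE /lin !ev1 // szE ?edgeP.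
  apply/(gens_syzygyP (s := lin w)); first exact: d0E.
  have [zs zd] := L1 w.
  by rewrite sum_div_vertex_mon // big1 // => v' _; rewrite zd mul0r.
- move=> w; split=> [|[u ->]]; last first.
    rewrite d0E d1E; apply/rowP => k; rewrite !mxE /lin !ev1;
      try exact: divfree_circulation.
    have [_ /(_ (enum_val k)) /eqP] := L2 u;
      rewrite addrC addr_eq0 => /eqP /= ->; ring.
  rewrite d0E => w0; have [|y yc yE] := divfree_dvd (L1 w).
    move=> p pe; have := congr1 (fun A : 'rV_ _ => A 0 (enum_rank_in pe p)) w0.
    by rewrite !mxE enum_rankK_in.
  exists (coords Q2 y); rewrite d1E -[LHS]co1; apply/rowP => k; rewrite !mxE.
  by apply: eq_bigr => p _; rewrite yE ev2.
move=> u; rewrite d1E => u0; rewrite -[u]co2; apply/rowP => k.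
rewrite !mxE big1 // => p _.
have : 'X_p.1 * lincomb B2 u p = 0.
  rewrite -(ev1 _ (divfree_circulation (L2 u))) u0 /lincomb big1 // => l _.
  by rewrite mxE mul0r.
by move/eqP; rewrite mulf_eq0 (negbTE (X_neq0 _ _)) /= => /eqP ->;
  rewrite mul0r.
Qed.

End ConnectedGraph.

(** * The characterization *)

(** If neighbours are unique, then the two ends of an edge form a set closed
under adjacency, hence a component. *)
Lemma disjoint_edgesP n (e : rel 'I_n) (e_sym : symmetric e)
    (e_irr : irreflexive e) (e_iso : no_isolated_vertex e) :
  disjoint_union_of_edges e <-> forall i j k, e i j -> e i k -> j = k.
Proof.
split=> [disj i j k eij eik|uniq_nbr i].
  have [u [w [_ /setP comp]]] := disj i.
  have mem x : connect e i x -> (x == u) || (x == w) by have := comp x;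
    rewrite !inE => ->.
  have ij := dart_neq e_irr eij; have ik := dart_neq e_irr eik.
  move: (mem i (connect0 _ _)) (mem j (connect1 eij)) (mem k (connect1 eik)) ij
    ik.
  by do 3![case/orP=> /eqP ->]; rewrite ?eqxx.
have [j eij] := e_iso i; exists i, j; split=> //.
have closed_ij : closed e (mem [set i; j]).
  apply: intro_closed => [|x y exy]; first exact: sym_connect_sym.
  rewrite !inE => /orP[] /eqP xE; subst x;
    first by rewrite (uniq_nbr _ _ _ exy eij) eqxx orbT.
  by rewrite e_sym in eij; rewrite (uniq_nbr _ _ _ exy eij) eqxx.
apply/setP => x; rewrite inE; apply/idP/idP => [/(closed_connect closed_ij)|].
  by rewrite !inE eqxx => <-.
by rewrite !inE => /orP[] /eqP ->; [apply: connect0 | apply: connect1].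
Qed.

Theorem corollary3p4 (n : nat) (K : fieldType) (e : rel 'I_n)
    (hn : (4 <= n)%N) (e_sym : symmetric e) (e_irr : irreflexive e)
    (e_iso : no_isolated_vertex e) :
  has_pure_resolution (complementary_edge_ideal K e) <->
  graph_connected e \/ disjoint_union_of_edges e.
Proof.
split=> [pure|[conn|/(disjoint_edgesP e_sym e_irr e_iso) uniq_nbr]]; last first.
- exact: matching_pure.
- exact: connected_pure.
have [/forallP conn|/forallPn[i /forallPn[j ncij]]] :=
  boolP [forall i, forall j, connect e i j].
  by left=> i j; apply/forallP.
right; apply/disjoint_edgesP => // v a b eva evb; apply/eqP/negPn/negP => ab.
have [i' eii'] := e_iso i; have [j' ejj'] := e_iso j.
exact: (pure_no_cherry_and_split e_sym e_irr (ltnW (ltnW hn)) pure eva evb ab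
  eii' ejj' ncij).
Qed.
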